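(* Let $\lambda_1\ge\lambda_2\ge2$ and $h_1\ge h_2\ge 2$ be integers and let $\lambda=(\lambda_1,\lambda_2,2^{h_2-2},1^{h_1-h_2})$, a partition of $n=\lambda_1+\lambda_2+h_1+h_2-4$. If $h_1\le m\le n-(\lambda_1-1)$, then $$|\mathrm{QYT}_{=m}(\lambda)|=\frac{\lambda_1-\lambda_2+1}{m-h_2+1}\binom{\lambda_1+h_1-2}{m-h_2}\binom{\lambda_2+h_1-3}{m-h_2}\binom{m-h_2}{m-h_1}\binom{\lambda_2+h_2-4}{h_2-2}\binom{\lambda_1+h_2-3}{h_2-2}\frac{1}{\binom{h_1-1}{h_2-2}}.$$
   Context: The notation $(\lambda_1,\lambda_2,2^{h_2-2},1^{h_1-h_2})$ denotes the partition with rows of lengths $\lambda_1,\lambda_2$, followed by $h_2-2$ rows of length $2$, followed by $h_1-h_2$ rows of length $1$; it has Durfee size $2$, first column of height $h_1$ and second column of height $h_2$. The (French) Young diagram has $\lambda_j$ left-justified boxes in row $j$, rows numbered from bottom to top. A semistandard Young tableau (SSYT) of shape $\lambda$ is a filling of the boxes with positive integers weakly increasing left to right along rows and strictly increasing bottom to top along columns. An SSYT $T$ is quasi-Yamanouchi if for every integer $i>1$ appearing in $T$, the leftmost occurrence of $i$ lies in a column weakly left of (column index $\le$) some occurrence of $i-1$. $\mathrm{QYT}_{=m}(\lambda)$ is the set of quasi-Yamanouchi tableaux of shape $\lambda$ whose largest entry is exactly $m$. *)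

(* Defs.v *)
From mathcomp Require Import all_boot all_order all_algebra.
Set Implicit Arguments. Unset Strict Implicit. Unset Printing Implicit Defensive.

(* A partition is a weakly decreasing seq of row lengths lam = [:: lam_1; lam_2; ...].
   Cells are pairs (row, column), 0-indexed; row 0 is the bottom row (French).
   Cell (i, j) belongs to the diagram iff i < size lam and j < lam_(i+1). *)
Definition in_shape (lam : seq nat) (i j : nat) : bool :=
  (i < size lam) && (j < nth 0 lam i).

(* A filling with entries bounded by m is a finite function on the bounding
   rectangle (size lam rows, head lam = lam_1 columns) with values in 0..m;
   cells outside the diagram carry the dummy value 0, so such fillings are in
   bijection with fillings of the diagram by {1..m}. *)
Definition filling (lam : seq nat) (m : nat) :=
  {ffun 'I_(size lam) * 'I_(head 0 lam) -> 'I_m.+1}.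

Definition ins (lam : seq nat) (x : 'I_(size lam) * 'I_(head 0 lam)) : bool :=
  in_shape lam x.1 x.2.

Definition is_QYT_eq (lam : seq nat) (m : nat) (T : filling lam m) : bool :=
  [&&
      [forall x, ~~ ins x ==> (nat_of_ord (T x) == 0)],
      [forall x, ins x ==> (0 < T x)],
      [forall x, forall y,
          [&& ins x, ins y, x.1 == y.1 & (x.2 < y.2)%N] ==> (T x <= T y)%N],
      [forall x, forall y,
          [&& ins x, ins y, x.2 == y.2 & (x.1 < y.1)%N] ==> (T x < T y)%N],
      (* largest entry is exactly m (all entries are <= m by typing) *)
      [exists x, ins x && (nat_of_ord (T x) == m)] &
      [forall i : 'I_m.+1,
          ((1 < i)%N && [exists x, ins x && (T x == i)]) ==>
          [exists x, [&& ins x, T x == i,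
              [forall y, (ins y && (T y == i)) ==> (x.2 <= y.2)%N] &
              [exists z, [&& ins z, nat_of_ord (T z) == i.-1 & (x.2 <= z.2)%N]]]]]].

Definition QYT_eq_card (lam : seq nat) (m : nat) : nat :=
  #|[pred T : filling lam m | is_QYT_eq T]|.

Definition hook2 (l1 l2 h1 h2 : nat) : seq nat :=
  [:: l1; l2] ++ nseq (h2 - 2) 2 ++ nseq (h1 - h2) 1.

(* Main.v *)
Require Import Defs.
From mathcomp Require Import all_boot all_order all_algebra.
From mathcomp Require Import zify ring.
Set Implicit Arguments. Unset Strict Implicit. Unset Printing Implicit Defensive.
Import Order.TTheory GRing.Theory Num.Theory.

(** Let [T] be quasi-Yamanouchi with largest entry [m] and let [c] be the corner of its
rightmost [m]. Erasing [c] gives a quasi-Yamanouchi tableau with largest entry [m - 1]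
whose rightmost [m - 1] is weakly right of [c], or one with largest entry [m] whose
rightmost [m] is strictly left of [c], and both cases are reversible. For a diagram with
Frobenius coordinates [(a1, a2 | b1, b2)] the corners, from right to left, sit at the ends of
the arms [a1], [a2] and of the legs [b2], [b1]; a rightmost [m] on arm [a1] (resp. leg [b1])
imposes no condition on the smaller tableau, and one on [a2] (resp. [b2]) only distinguishes
whether the next rightmost entry lies on [a1] (resp. [b1]). The numbers [f(m)] of
tableaux therefore satisfy a linear recurrence without refinement. Writing [L - x] for the
diagram [L] with [x] shortened by one cell,
  [f_L(m) = f_(L-a1)(m) + f_(L-b1)(m-1)
     + f_(L-b2)(m-1) + f_(L-b1-b2)(m-1) - f_(L-b1-b2)(m-2)
     + f_(L-a2)(m) - f_(L-a1-a2)(m) + f_(L-a1-a2)(m-1)].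
It is solved by [(a1-a2) (b1-b2) prod (ai+bj)! / (prod ai! bj! (d-bj)! (e-ai)!)], where
[d = m - 1] and [d + e + 1] is the number of cells. When [a2 = b2 = 0] the inner corner
belongs to both [a2] and [b2], and its removal leaves a hook. *)

Lemma card_set_bij (aT rT : finType) (A : {set aT}) (B : {set rT})
    (f : aT -> rT) (g : rT -> aT) :
  (forall x, x \in A -> f x \in B /\ g (f x) = x) ->
  (forall y, y \in B -> g y \in A /\ f (g y) = y) -> #|A| = #|B|.
Proof.
move=> fA gB; apply/eqP; rewrite eqn_leq; apply/andP; split.
  rewrite -(card_in_imset (f := f) (D := A)); last first.
    by move=> x y /fA[_ xK] /fA[_ yK] e; rewrite -xK -yK e.
  by apply/subset_leq_card/subsetP=> _ /imsetP[x /fA[? _] ->].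
rewrite -(card_in_imset (f := g) (D := B)); last first.
  by move=> x y /gB[_ xK] /gB[_ yK] e; rewrite -xK -yK e.
by apply/subset_leq_card/subsetP=> _ /imsetP[x /gB[? _] ->].
Qed.

(** * Quasi-Yamanouchi fillings of an arbitrary set of cells *)

Section Tableaux.
Variables R C M : nat.
Local Notation cell := ('I_R * 'I_C)%type.
Local Notation tab := {ffun cell -> 'I_M.+1}.
Implicit Types (S : {set cell}) (T : tab) (c x y z : cell) (m k i : nat).

(** All fillings share one type with entries up to [M], so erasing a cell changes [S] and [m] but
    not the type. The last two clauses make every value from 1 to [m] occur, and the link compares
    some occurrence of [i.+1] instead of the leftmost one, which is equivalent. For [m = 0] only the
    empty [S] admits a filling. *)
Definition QY S m T : bool :=
  [&& [forall x, (x \notin S) ==> (T x == 0 :> nat)],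
      [forall x in S, 0 < T x],
      [forall x, T x <= m],
      [forall x in S, forall y in S, (x.1 == y.1) && (x.2 < y.2) ==> (T x <= T y)],
      [forall x in S, forall y in S, (x.2 == y.2) && (x.1 < y.1) ==> (T x < T y)],
      (0 < m) ==> [exists x, T x == m :> nat] &
      [forall i : 'I_m, (0 < i) ==>
         [exists x, exists z, [&& T x == i.+1 :> nat, T z == i :> nat & x.2 <= z.2]]]].

Record QY_spec S m T : Prop := QYSpec {
  QY_out : forall x, x \notin S -> T x = 0 :> nat;
  QY_pos : forall x, x \in S -> 0 < T x;
  QY_le : forall x, T x <= m;
  QY_row : forall x y, x \in S -> y \in S -> x.1 = y.1 -> x.2 < y.2 -> T x <= T y;
  QY_col : forall x y, x \in S -> y \in S -> x.2 = y.2 -> x.1 < y.1 -> T x < T y;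
  QY_max : 0 < m -> exists x, T x = m :> nat;
  QY_link : forall i, 0 < i < m ->
    exists x z, [/\ T x = i.+1 :> nat, T z = i :> nat & x.2 <= z.2] }.

Lemma QYP S m T : reflect (QY_spec S m T) (QY S m T).
Proof.
apply: (iffP idP).
  case/and5P=> /forallP H1 /forall_inP H2 /forallP H3 /forall_inP H4 /and3P[/forall_inP H5 H6 /forallP H7].
  split.
  - by move=> x xS; apply/eqP; have /implyP := H1 x; apply.
  - by [].
  - by [].
  - move=> x y xS yS e l; have /forall_inP/(_ y yS)/implyP := H4 x xS.
    by apply; rewrite e eqxx.
  - move=> x y xS yS e l; have /forall_inP/(_ y yS)/implyP := H5 x xS.
    by apply; rewrite e eqxx.
  - by move=> m0; move: H6; rewrite m0 => /existsP[x /eqP]; exists x.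
  - move=> i /andP[i0 im]; have /implyP/(_ i0) := H7 (Ordinal im).
    by case/existsP=> x /existsP[z /and3P[/eqP ? /eqP ? ?]]; exists x, z.
case=> H1 H2 H3 H4 H5 H6 H7; apply/and5P; split.
- by apply/forallP=> x; apply/implyP=> /H1 ->.
- by apply/forall_inP.
- by apply/forallP.
- apply/forall_inP=> x xS; apply/forall_inP=> y yS; apply/implyP=> /andP[/eqP e l].
  exact: H4.
apply/and3P; split.
- apply/forall_inP=> x xS; apply/forall_inP=> y yS; apply/implyP=> /andP[/eqP e l].
  exact: H5.
- by apply/implyP=> /H6[x e]; apply/existsP; exists x; rewrite e.
- apply/forallP=> i; apply/implyP=> i0.
  have [x [z [e1 e2 l]]] : exists x z, [/\ T x = i.+1 :> nat, T z = i :> nat & x.2 <= z.2].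
    by apply: H7; rewrite i0 /=.
  by apply/existsP; exists x; apply/existsP; exists z; rewrite e1 e2 l !eqxx.
Qed.

(** * Counting by the rightmost occurrence of the largest entry *)

Definition rightmost m T c :=
  (T c == m :> nat) && [forall x, (T x == m :> nat) ==> (x != c) ==> (x.2 < c.2)].

Lemma rightmostP m T c :
  reflect (T c = m :> nat /\ forall x, T x = m :> nat -> x != c -> x.2 < c.2)
          (rightmost m T c).
Proof.
apply: (iffP andP) => -[/eqP e H]; split=> //.
  by move=> x /eqP ex xc; have /forallP/(_ x) := H; rewrite ex xc.
by apply/forallP=> x; apply/implyP=> /eqP ex; apply/implyP=> /(H _ ex).
Qed.

(** For [m = 0] the condition is vacuous: if the erased cell held the only 1, there is no smaller
    entry to link it to. *)
Definition reaches k m T :=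
  (m == 0) || [exists z, (T z == m :> nat) && (k <= z.2)].

Lemma reachesP k m T :
  reflect (m = 0 \/ exists2 z, T z = m :> nat & k <= z.2) (reaches k m T).
Proof.
apply: (iffP orP) => -[].
- by move/eqP; left.
- by case/existsP=> z /andP[/eqP ? ?]; right; exists z.
- by move=> ->; left.
- by case=> z e l; right; apply/existsP; exists z; rewrite e eqxx.
Qed.

Definition nQY S m := #|[set T | QY S m T]|.
Definition nQY_reach S k m := #|[set T | QY S m T && reaches k m T]|.
Definition nQY_short S k m := #|[set T | QY S m T && ~~ reaches k m T]|.
Definition nQY_at S c m := #|[set T | QY S m T && rightmost m T c]|.

Lemma nQY_split S k m : nQY S m = nQY_reach S k m + nQY_short S k m.
Proof.
rewrite /nQY -(cardsID [set T | reaches k m T]); congr (_ + _); apply: eq_card => T.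
  by rewrite !inE.
by rewrite !inE andbC.
Qed.

Lemma QY_in S m T x : QY S m T -> 0 < T x -> x \in S.
Proof. by move=> /QYP H; apply: contraLR => /(QY_out H) ->. Qed.

(** Columns are strict, so [m] occurs at most once per column and an occurrence of maximal column
    index is unique. *)
Lemma rightmost_ex S m T : QY S m T -> 0 < m ->
  exists2 c, rightmost m T c & forall c', rightmost m T c' = (c' == c).
Proof.
move=> q m0; have /QYP H := q; have [x0 /eqP ex0] := QY_max H m0.
have [c /eqP ec cmax] := @arg_maxnP _ x0 (fun x => T x == m :> nat) (fun x => x.2) ex0.
have rc : rightmost m T c.
  apply/rightmostP; split=> // x ex xc; rewrite ltn_neqAle [_ <= _]cmax ?ex // andbT.
  apply/eqP => /val_inj e2.
  have xS : x \in S by apply: (QY_in q); rewrite ex.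
  have cS : c \in S by apply: (QY_in q); rewrite ec.
  have /eqP ne : x.1 != c.1 by apply: contraNneq xc => e1; rewrite -pair_eqE /pair_eq /= e1 e2 !eqxx.
  have [l|l|/val_inj //] := ltngtP x.1 c.1.
    by have := QY_col H xS cS e2 l; rewrite ex ec ltnn.
  by have := QY_col H cS xS (esym e2) l; rewrite ex ec ltnn.
exists c => // c'; apply/idP/eqP => [|-> //] /rightmostP[e H'].
apply/eqP/negPn/negP => ne; have /rightmostP[_ H''] := rc.
have := H'' _ e ne; have := H' _ ec; rewrite eq_sym => /(_ ne); lia.
Qed.

(** Double counting of pairs formed by a tableau and its rightmost [m]; [p] has to depend on that
    cell only. *)
Lemma card_by_rightmost S m (p : pred tab) (q : pred cell) : 0 < m ->
  (forall T c, QY S m T -> rightmost m T c -> p T = q c) ->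
  #|[set T | QY S m T && p T]| = \sum_(c | q c) nQY_at S c m.
Proof.
move=> m0 pq; rewrite /nQY_at -sum1_card.
under [RHS]eq_bigr do rewrite -sum1_card.
rewrite (exchange_big_dep [in [set T | QY S m T && p T]]) /=; last first.
  by move=> c T qc; rewrite !inE => /andP[qT /(pq _ _ qT) ->]; rewrite qT qc.
apply: eq_bigr => T; rewrite !inE => /andP[qT pT].
have [c rc uc] := rightmost_ex qT m0.
rewrite (big_pred1 c) // => c'; rewrite !inE qT /= uc andbC /=.
by case: eqP => // ->; rewrite -(pq _ _ qT rc).
Qed.

Lemma reaches_rightmost S m k T c : 0 < m -> QY S m T -> rightmost m T c ->
  reaches k m T = (k <= c.2).
Proof.
move=> m0 qT /rightmostP[e H]; apply/reachesP/idP => [[m00|[z ez kz]]|kc].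
- by rewrite m00 in m0.
- have [zc|/(H _ ez)] := eqVneq z c; first by rewrite -zc.
  by move=> /ltnW; apply: leq_trans.
- by right; exists c.
Qed.

Lemma nQY_sum S m : 0 < m -> nQY S m = \sum_c nQY_at S c m.
Proof.
move=> m0; rewrite -(@card_by_rightmost S m predT predT) //.
by apply: eq_card => T; rewrite !inE andbT.
Qed.

Lemma nQY_reach_sum S k m : 0 < m -> nQY_reach S k m = \sum_(c : cell | k <= c.2) nQY_at S c m.
Proof. by move=> m0; apply: card_by_rightmost => // T c; apply: reaches_rightmost. Qed.

Lemma nQY_short_sum S k m : 0 < m -> nQY_short S k m = \sum_(c : cell | c.2 < k) nQY_at S c m.
Proof.
move=> m0; apply: card_by_rightmost => // T c qT rT.
by rewrite (reaches_rightmost k m0 qT rT) ltnNge.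
Qed.

(* Only the row and the column of [c] are inspected, so [S] need not be a diagram. *)
Definition corner S c : Prop :=
  [/\ c \in S, forall x, x \in S -> x.1 = c.1 -> x.2 <= c.2
    & forall x, x \in S -> x.2 = c.2 -> x.1 <= c.1].

(** An entry right of [c] in its row would be another [m] further right, and one above [c] would
    exceed [m]. *)
Lemma nQY_at_corner S c m : 0 < m -> nQY_at S c m != 0 -> corner S c.
Proof.
move=> m0; rewrite -lt0n => /card_gt0P[T]; rewrite inE => /andP[q /rightmostP[e H]].
have /QYP QT := q.
have cS : c \in S by apply: (QY_in q); rewrite e.
split=> // x xS; rewrite [_ <= _]leqNgt => exc; apply/negP => l.
  have := QY_row QT cS xS (esym exc) l; rewrite e => l'.
  have ex : T x = m :> nat by apply/eqP; rewrite eqn_leq l' (QY_le QT).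
  have xc : x != c by apply: contraTneq l => ->; rewrite ltnn.
  by have := H _ ex xc; rewrite ltnNge ltnW.
by have := QY_col QT cS xS (esym exc) l; rewrite e ltnNge (QY_le QT).
Qed.

Lemma nQY_zero S m : (exists x, x \in S) -> m = 0 -> nQY S m = 0.
Proof.
move=> [x xS] ->; apply: eq_card0 => T; rewrite !inE; apply/negP => /QYP H.
by have := QY_pos H xS; rewrite ltnNge (QY_le H).
Qed.

Lemma nQY_at_zero S c m : c \in S -> m = 0 -> nQY_at S c m = 0.
Proof.
move=> xS ->; apply: eq_card0 => T; rewrite !inE; apply/negP => /andP[/QYP H _].
by have := QY_pos H xS; rewrite ltnNge (QY_le H).
Qed.

(** * Erasing and restoring the rightmost largest entry *)

Definition upd T c (v : 'I_M.+1) : tab := [ffun x => if x == c then v else T x].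

Lemma updK T c v w : T c = w -> upd (upd T c v) c w = T.
Proof. by move=> e; apply/ffunP => x; rewrite !ffunE; case: eqP => // ->. Qed.

Lemma upd_same T c v : upd T c v c = v.
Proof. by rewrite ffunE eqxx. Qed.

Lemma upd_other T c v x : x != c -> upd T c v x = T x.
Proof. by rewrite ffunE => /negPf ->. Qed.

(** The summands separate the tableaux in which [c] holds the only [m.+1] from those with another
    [m.+1]. Either way, erasing writes 0 into [c] and the inverse writes [m.+1] back, which respects
    rows and columns because [c] is a corner. *)
Lemma nQY_at_rec S c m : m < M -> corner S c ->
  nQY_at S c m.+1 = nQY_reach (S :\ c) c.2 m + nQY_short (S :\ c) c.2 m.+1.
Proof.
move=> mM [cS cR cC].
have em : (inord m.+1 : 'I_M.+1) = m.+1 :> nat by rewrite inordK.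
pose solo := [set T : tab | [forall x, (T x == m.+1 :> nat) ==> (x == c)]].
rewrite /nQY_at -(cardsID solo); congr (_ + _).
- apply: (@card_set_bij _ _ _ _ (fun T => upd T c ord0) (fun T => upd T c (inord m.+1))).
  + move=> T; rewrite !inE => /andP[/andP[qT /rightmostP[e H]] /forallP solo_T].
    have /QYP Q := qT.
    have lt_m x : x != c -> T x <= m.
      move=> xc; have := QY_le Q x; rewrite leq_eqVlt ltnS => /orP[ex|//].
      by have := solo_T x; rewrite ex (negPf xc).
    split; last by apply: updK; apply: val_inj; rewrite /= e em.
    apply/andP; split.
      apply/QYP; split.
      * move=> x; rewrite !inE negb_and negbK; have [-> _|xc /=] := eqVneq x c.
          by rewrite upd_same.
        by rewrite upd_other //; apply: (QY_out Q).
      * by move=> x; rewrite !inE => /andP[xc /(QY_pos Q)]; rewrite upd_other.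
      * by move=> x; have [->|xc] := eqVneq x c; rewrite ?upd_same ?upd_other ?lt_m.
      * move=> x y; rewrite !inE => /andP[xc xS] /andP[yc yS].
        by rewrite !upd_other //; apply: (QY_row Q).
      * move=> x y; rewrite !inE => /andP[xc xS] /andP[yc yS].
        by rewrite !upd_other //; apply: (QY_col Q).
      * move=> m0; have [|x [z [ex ez l]]] := QY_link Q (i := m).
          by rewrite m0 leqnn.
        exists z; rewrite upd_other //; apply: contra_eqN ez => /eqP ->.
        by rewrite e neq_ltn ltnSn orbT.
      * move=> i /andP[i0 im]; have [|x [z [ex ez l]]] := QY_link Q (i := i).
          by rewrite i0 ltnW.
        exists x, z; rewrite !upd_other //.
          by apply: contra_eqN ez => /eqP ->; rewrite e; lia.
        by apply: contra_eqN ex => /eqP ->; rewrite e; lia.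
    apply/reachesP; have [->|m0] := posnP m; [by left | right].
    (* The link from [m.+1] to [m] can only start at [c], so it exhibits an [m] weakly right of
       [c]. *)
    have [|x [z [ex ez l]]] := QY_link Q (i := m); first by rewrite m0 leqnn.
    have xc : x = c by apply/eqP; have := solo_T x; rewrite ex eqxx.
    exists z; last by rewrite -xc.
    by rewrite upd_other //; apply: contra_eqN ez => /eqP ->; rewrite e; lia.
  + move=> T; rewrite !inE => /andP[qT /reachesP rT]; have /QYP Q := qT.
    have Tc : T c = 0 :> nat by apply: (QY_out Q); rewrite !inE eqxx.
    have lt_m x : T x = m.+1 :> nat -> False by move=> ex; have := QY_le Q x; rewrite ex ltnn.
    split; last by apply: updK; apply: val_inj; rewrite /= Tc.
    apply/andP; split; last first.
      apply/forallP=> x; apply/implyP; have [//|xc] := eqVneq x c.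
      by rewrite upd_other // => /eqP /lt_m.
    apply/andP; split; last first.
      apply/rightmostP; split=> [|x]; first by rewrite upd_same em.
      by move=> + xc; rewrite upd_other // => /lt_m.
    apply/QYP; split.
    * move=> x xS; have xc : x != c by apply: contraNneq xS => ->.
      by rewrite upd_other //; apply: (QY_out Q); rewrite !inE (negPf xS) andbF.
    * move=> x xS; have [->|xc] := eqVneq x c; first by rewrite upd_same em.
      by rewrite upd_other //; apply: (QY_pos Q); rewrite !inE xc.
    * move=> x; have [->|xc] := eqVneq x c; first by rewrite upd_same em.
      by rewrite upd_other //; apply: leqW; apply: (QY_le Q).
    * move=> x y xS yS e12 l; have [yc|yc] := eqVneq y c.
        rewrite yc upd_same em; have [->|xc] := eqVneq x c; first by rewrite upd_same em.
        by rewrite upd_other //; apply: leqW; apply: (QY_le Q).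
      have xc : x != c.
        by apply: contraTneq l => xc; rewrite -leqNgt xc cR // -e12 xc.
      by rewrite !upd_other //; apply: (QY_row Q) => //; rewrite !inE ?xc ?yc.
    * move=> x y xS yS e12 l.
      have xc : x != c.
        by apply: contraTneq l => xc; rewrite -leqNgt xc cC // -e12 xc.
      have [yc|yc] := eqVneq y c.
        by rewrite yc upd_same em upd_other // ltnS; apply: (QY_le Q).
      by rewrite !upd_other //; apply: (QY_col Q) => //; rewrite !inE ?xc ?yc.
    * by exists c; rewrite upd_same em.
    * move=> i /andP[i0]; rewrite ltnS leq_eqVlt => /orP[/eqP im|im].
        (* The one new link goes from the restored [m.+1] to [m], and [reaches] supplies it. *)
        case: rT => [m0|[z ez l]]; first by rewrite im m0 in i0.
        exists c, z; rewrite upd_same em upd_other; first by rewrite im.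
        by apply: contra_eqN ez => /eqP ->; rewrite Tc -im neq_ltn i0.
      have [|x [z [ex ez l]]] := QY_link Q (i := i); first by rewrite i0.
      exists x, z; rewrite !upd_other //.
        by apply: contra_eqN ez => /eqP ->; rewrite Tc; lia.
      by apply: contra_eqN ex => /eqP ->; rewrite Tc; lia.
- apply: (@card_set_bij _ _ _ _ (fun T => upd T c ord0) (fun T => upd T c (inord m.+1))).
  + move=> T; rewrite !inE => /andP[nsolo /andP[qT /rightmostP[e H]]].
    have /QYP Q := qT.
    have {nsolo} [x0 ex0 x0c] : exists2 x, T x = m.+1 :> nat & x != c.
      move: nsolo; rewrite negb_forall => /existsP[x].
      by rewrite negb_imply => /andP[/eqP]; exists x.
    split; last by apply: updK; apply: val_inj; rewrite /= e em.
    apply/andP; split; last first.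
      apply/reachesP=> -[//|[z]]; have [->|zc] := eqVneq z c; first by rewrite upd_same.
      by rewrite upd_other // => ez; rewrite leqNgt H.
    apply/QYP; split.
    * move=> x; rewrite !inE negb_and negbK; have [-> _|xc /=] := eqVneq x c.
        by rewrite upd_same.
      by rewrite upd_other //; apply: (QY_out Q).
    * by move=> x; rewrite !inE => /andP[xc /(QY_pos Q)]; rewrite upd_other.
    * move=> x; have [->|xc] := eqVneq x c; rewrite ?upd_same ?upd_other //.
      exact: (QY_le Q).
    * move=> x y; rewrite !inE => /andP[xc xS] /andP[yc yS].
      by rewrite !upd_other //; apply: (QY_row Q).
    * move=> x y; rewrite !inE => /andP[xc xS] /andP[yc yS].
      by rewrite !upd_other //; apply: (QY_col Q).
    * by move=> _; exists x0; rewrite upd_other.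
    * move=> i /andP[i0 im]; have [|x [z [ex ez l]]] := QY_link Q (i := i).
        by rewrite i0.
      have zc : z != c by apply: contra_eqN ez => /eqP ->; rewrite e; lia.
      have [xc|xc] := eqVneq x c; last by exists x, z; rewrite !upd_other.
      (* A link that started at the erased cell can start at the surviving [m.+1] in [x0], which
         lies further left. *)
      exists x0, z; rewrite !upd_other //; split=> //; first by rewrite ex0 -ex xc e.
      by apply: leq_trans l; rewrite xc; apply/ltnW/H.
  + move=> T; rewrite !inE => /andP[qT /reachesP rT]; have /QYP Q := qT.
    have Tc : T c = 0 :> nat by apply: (QY_out Q); rewrite !inE eqxx.
    have Hlt x : T x = m.+1 :> nat -> x.2 < c.2.
      by move=> ex; rewrite ltnNge; apply/negP => l; apply: rT; right; exists x.
    split; last by apply: updK; apply: val_inj; rewrite /= Tc.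
    have [//|x0 ex0] := QY_max Q.
    have x0c : x0 != c by apply: contra_eqN ex0 => /eqP ->; rewrite Tc.
    apply/andP; split.
      apply/negP => /forallP/(_ x0); rewrite upd_other // ex0 eqxx /=.
      by rewrite (negPf x0c).
    apply/andP; split; last first.
      apply/rightmostP; split=> [|x]; first by rewrite upd_same em.
      by move=> + xc; rewrite upd_other // => /Hlt.
    apply/QYP; split.
    * move=> x xS; have xc : x != c by apply: contraNneq xS => ->.
      by rewrite upd_other //; apply: (QY_out Q); rewrite !inE (negPf xS) andbF.
    * move=> x xS; have [->|xc] := eqVneq x c; first by rewrite upd_same em.
      by rewrite upd_other //; apply: (QY_pos Q); rewrite !inE xc.
    * move=> x; have [->|xc] := eqVneq x c; first by rewrite upd_same em.
      by rewrite upd_other //; apply: (QY_le Q).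
    * move=> x y xS yS e12 l; have [yc|yc] := eqVneq y c.
        rewrite yc upd_same em; have [->|xc] := eqVneq x c; first by rewrite upd_same em.
        by rewrite upd_other //; apply: (QY_le Q).
      have xc : x != c.
        by apply: contraTneq l => xc; rewrite -leqNgt xc cR // -e12 xc.
      by rewrite !upd_other //; apply: (QY_row Q) => //; rewrite !inE ?xc ?yc.
    * move=> x y xS yS e12 l.
      have xc : x != c.
        by apply: contraTneq l => xc; rewrite -leqNgt xc cC // -e12 xc.
      have [yc|yc] := eqVneq y c; last first.
        by rewrite !upd_other //; apply: (QY_col Q) => //; rewrite !inE ?xc ?yc.
      (* Strictness below [c] holds because every [m.+1] of [T] lies in a column strictly left of
         [c]. *)
      rewrite yc upd_same em upd_other // ltn_neqAle (QY_le Q) andbT.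
      by apply/eqP => /Hlt; rewrite e12 yc ltnn.
    * by exists c; rewrite upd_same em.
    * move=> i /andP[i0 im].
      have [|x [z [ex ez l]]] := QY_link Q (i := i); first by rewrite i0.
      exists x, z; rewrite !upd_other //.
        by apply: contra_eqN ez => /eqP ->; rewrite Tc; lia.
      by apply: contra_eqN ex => /eqP ->; rewrite Tc; lia.
Qed.

(** * Corner recurrences freed of the column condition *)

Lemma nQY_reach_all S k m : 0 < m -> (forall x, x \in S -> x.2 < k) -> nQY_reach S k m = 0.
Proof.
move=> m0 Sk; apply: eq_card0 => T; rewrite !inE; apply/negP => /andP[qT /reachesP].
case=> [m00|[z ez]]; first by rewrite m00 in m0.
by rewrite leqNgt Sk //; apply: (QY_in qT); rewrite ez.
Qed.

Lemma nQY_short0 S m : nQY_short S 0 m = 0.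
Proof.
apply: eq_card0 => T; rewrite !inE; apply/negP => /andP[qT /reachesP]; case.
have [->|m0] := posnP m; [by left | right].
by have /QYP Q := qT; have [x ex] := QY_max Q m0; exists x.
Qed.

Lemma nQY_short_zero S k : nQY_short S k 0 = 0.
Proof. by apply: eq_card0 => T; rewrite !inE /reaches /= andbF. Qed.

Lemma nQY_reach_zero S k : (exists x, x \in S) -> nQY_reach S k 0 = 0.
Proof.
by move=> S0; have := nQY_split S k 0; rewrite (nQY_zero S0) //; case: (nQY_reach S k 0).
Qed.

(** No remaining cell reaches column [c.2], so in [nQY_at_rec] the first summand vanishes and the
    second is unrestricted. If the first summand has maximum 0, it vanishes because [S :\ c] is
    non-empty. *)
Lemma nQY_at_last_col S c m : m <= M -> corner S c -> (exists x, x \in S :\ c) ->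
  (forall x, x \in S :\ c -> x.2 < c.2) -> nQY_at S c m = nQY (S :\ c) m.
Proof.
case: m => [|m] mM cS S0 Sc.
  by rewrite (nQY_zero S0) // nQY_at_zero //; case: cS.
rewrite nQY_at_rec // (nQY_split _ c.2) (nQY_reach_all (ltn0Sn m) Sc).
have [->|m0] := posnP m; first by rewrite nQY_reach_zero.
by rewrite nQY_reach_all.
Qed.

Lemma nQY_at_first_col S c m : m < M -> corner S c -> c.2 = 0 :> nat ->
  nQY_at S c m.+1 = nQY (S :\ c) m.
Proof.
by move=> mM cS c0; rewrite nQY_at_rec // c0 (nQY_split _ 0) !nQY_short0 !addn0.
Qed.

(** A rightmost [m] that misses column 1 sits in column 0, whose only corner is [c]. For [m = 0]
    both sides are zero. *)
Lemma nQY_short_first_col S c m : m <= M -> corner S c -> c.2 = 0 :> nat ->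
  (exists x, x \in S :\ c) -> nQY_short S 1 m = nQY (S :\ c) m.-1.
Proof.
case: m => [|m] mM cS c0 S0; first by rewrite nQY_short_zero (nQY_zero S0).
rewrite nQY_short_sum // (bigD1 c) ?c0 //= big1 ?addn0 ?nQY_at_first_col //.
move=> x /andP[x0 xc]; apply/eqP/negPn/negP => /nQY_at_corner => /(_ isT)[xS _ xC].
case: cS => cS _ cC; case/negP: xc.
have e2 : x.2 = c.2 by apply: val_inj => /=; rewrite c0; move: x0; case: (val x.2).
have e1 : x.1 = c.1.
  by apply: val_inj; apply/eqP; rewrite eqn_leq cC // xC.
by rewrite -pair_eqE /pair_eq /= e1 e2 !eqxx.
Qed.

(** A corner in column at least [k] shares the row of [c], hence is [c]; reaching column [k] thus
    means that the rightmost [m] is at [c]. *)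
Lemma nQY_reach_last_col S c k m : m <= M -> corner S c -> k <= c.2 ->
  (exists x, x \in S :\ c) -> (forall x, x \in S :\ c -> x.2 < c.2) ->
  (forall x, x \in S -> x.1 = c.1 \/ x.2 < k) -> nQY_reach S k m = nQY (S :\ c) m.
Proof.
move=> mM cS kc S0 Sc Sk; have [m0|m0] := posnP m.
  rewrite m0 nQY_reach_zero ?(nQY_zero S0) //.
  by case: S0 => x; rewrite inE => /andP[_ xS]; exists x.
rewrite nQY_reach_sum // (bigD1 c) //= big1 ?addn0 ?nQY_at_last_col //.
move=> x /andP[kx xc]; apply/eqP/negPn/negP => /nQY_at_corner => /(_ m0)[xS xR _].
case: (Sk x xS) => [e1|]; last by rewrite ltnNge kx.
have [cS' _ _] := cS; have := xR c cS' (esym e1).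
by rewrite leqNgt Sc // !inE xc.
Qed.

(** Missing column 1 forces the rightmost maximum onto [b], so the first summand of [nQY_at_rec] is
    a total minus such a count and the second is such a count. The negative term stands on the left
    to stay in [nat]. *)
Lemma nQY_at_second_col S c b m : m < M -> corner S c -> c.2 = 1 :> nat ->
  corner (S :\ c) b -> b.2 = 0 :> nat -> (exists x, x \in S :\ c :\ b) ->
  nQY_at S c m.+1 + nQY (S :\ c :\ b) m.-1 = nQY (S :\ c) m + nQY (S :\ c :\ b) m.
Proof.
move=> mM cS c1 bS b0 S0; rewrite nQY_at_rec // c1 (nQY_split (S :\ c) 1 m).
rewrite (nQY_short_first_col (ltnW mM) bS b0 S0) (nQY_short_first_col mM bS b0 S0) /=; lia.
Qed.

(** Dually, reaching column [c.2] forces the rightmost maximum onto [a], so it is the second summand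
    that becomes a difference. *)
Lemma nQY_at_second_row S c a m : m < M -> corner S c ->
  corner (S :\ c) a -> c.2 <= a.2 -> (exists x, x \in S :\ c :\ a) ->
  (forall x, x \in S :\ c :\ a -> x.2 < a.2) ->
  (forall x, x \in S :\ c -> x.1 = a.1 \/ x.2 < c.2) ->
  nQY_at S c m.+1 + nQY (S :\ c :\ a) m.+1 = nQY (S :\ c :\ a) m + nQY (S :\ c) m.+1.
Proof.
move=> mM cS aS ca S0 Sa Sc; rewrite nQY_at_rec // (nQY_split (S :\ c) c.2 m.+1).
by rewrite !(nQY_reach_last_col _ aS ca S0 Sa Sc) //; lia.
Qed.

(** Both reductions apply at once: the reaching summand lands on [a], the short one on [b]. *)
Lemma nQY_at_inner S c a b m : m < M -> corner S c -> c.2 = 1 :> nat ->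
  corner (S :\ c) a -> c.2 <= a.2 -> (exists x, x \in S :\ c :\ a) ->
  (forall x, x \in S :\ c :\ a -> x.2 < a.2) ->
  (forall x, x \in S :\ c -> x.1 = a.1 \/ x.2 < c.2) ->
  corner (S :\ c) b -> b.2 = 0 :> nat -> (exists x, x \in S :\ c :\ b) ->
  nQY_at S c m.+1 = nQY (S :\ c :\ a) m + nQY (S :\ c :\ b) m.
Proof.
move=> mM cS c1 aS ca S0 Sa Sc bS b0 S0'; rewrite nQY_at_rec //.
by rewrite (nQY_reach_last_col _ aS ca S0 Sa Sc) 1?ltnW // c1 (nQY_short_first_col mM bS b0 S0').
Qed.

(** * Diagrams of Durfee size two and their corners *)

(** As a union of two rows and two columns, the diagram loses an end cell by decreasing one
    parameter, and [l2 = h2 = 0] gives a hook. *)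
Definition diagram l1 l2 h1 h2 : {set cell} :=
  [set x : cell | [|| (x.1 == 0 :> nat) && (x.2 < l1), (x.1 == 1 :> nat) && (x.2 < l2),
     (x.2 == 0 :> nat) && (x.1 < h1) | (x.2 == 1 :> nat) && (x.1 < h2)]].

Lemma cell_eqE x y : (x == y) = (x.1 == y.1 :> nat) && (x.2 == y.2 :> nat).
Proof. by rewrite -pair_eqE /pair_eq. Qed.

Ltac cell_lia := rewrite ?inE ?cell_eqE; lia.
Ltac corner_lia :=
  split; [cell_lia | move=> x + /(congr1 val) /=; cell_lia
                   | move=> x + /(congr1 val) /=; cell_lia].
Section Shape.
Variables l1 l2 h1 h2 : nat.
Hypotheses (l22 : 2 <= l2) (l21 : l2 <= l1) (l1C : l1 <= C).
Hypotheses (h22 : 2 <= h2) (h21 : h2 <= h1) (h1R : h1 <= R).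
Variables a1 a2 b1 b2 : cell.
Hypotheses (a1r : a1.1 = 0 :> nat) (a1c : a1.2 = l1.-1 :> nat).
Hypotheses (a2r : a2.1 = 1 :> nat) (a2c : a2.2 = l2.-1 :> nat).
Hypotheses (b1r : b1.1 = h1.-1 :> nat) (b1c : b1.2 = 0 :> nat).
Hypotheses (b2r : b2.1 = h2.-1 :> nat) (b2c : b2.2 = 1 :> nat).
Local Notation sh := (diagram l1 l2 h1 h2).

Lemma shape_corner c : corner sh c -> [\/ c = a1, c = a2, c = b1 | c = b2].
Proof.
case=> cS cR cC.
have [a1S a2S b1S b2S] : [/\ a1 \in sh, a2 \in sh, b1 \in sh & b2 \in sh].
  by split; cell_lia.
have cell_inj x : x.1 = c.1 :> nat -> x.2 = c.2 :> nat -> c = x.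
  by move=> e1 e2; apply/eqP; rewrite cell_eqE e1 e2 !eqxx.
move: cS; rewrite inE => /or4P[] /andP[/eqP e l].
- have e1 : a1.1 = c.1 by apply: val_inj; rewrite /= a1r e.
  by apply/Or41/cell_inj; rewrite ?e1 //; have := cR _ a1S e1; lia.
- have e1 : a2.1 = c.1 by apply: val_inj; rewrite /= a2r e.
  by apply/Or42/cell_inj; rewrite ?e1 //; have := cR _ a2S e1; lia.
- have e1 : b1.2 = c.2 by apply: val_inj; rewrite /= b1c e.
  by apply/Or43/cell_inj; rewrite ?e1 //; have := cC _ b1S e1; lia.
- have e1 : b2.2 = c.2 by apply: val_inj; rewrite /= b2c e.
  by apply/Or44/cell_inj; rewrite ?e1 //; have := cC _ b2S e1; lia.
Qed.

(** Only the four ends can be corners, and [a2], [b2] coincide exactly when [l2 = h2 = 2]. An end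
    that is not a corner contributes zero. *)
Lemma shape_sum m : 0 < m -> (2 < l2) || (2 < h2) ->
  nQY sh m = nQY_at sh a1 m + nQY_at sh a2 m + nQY_at sh b1 m + nQY_at sh b2 m.
Proof.
move=> m0 lh; rewrite nQY_sum //.
rewrite (bigD1 a1) // (bigD1 a2) /=; last by cell_lia.
rewrite (bigD1 b1) /=; last by cell_lia.
rewrite (bigD1 b2) /=; last by cell_lia.
rewrite big1 ?addn0 ?addnA // => c cP; apply/eqP/negPn/negP => /nQY_at_corner => /(_ m0).
by case/shape_corner => e; move: cP; rewrite e !eqxx ?andbF.
Qed.

Lemma shape_sum22 m : 0 < m -> l2 = 2 -> h2 = 2 ->
  nQY sh m = nQY_at sh a1 m + nQY_at sh b1 m + nQY_at sh a2 m.
Proof.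
move=> m0 l2E h2E; rewrite nQY_sum //.
have ab : a2 = b2 by apply/eqP; cell_lia.
have Z c : c != a1 -> c != a2 -> c != b1 -> nQY_at sh c m = 0.
  move=> n1 n2 n3; apply/eqP/negPn/negP => /nQY_at_corner => /(_ m0) /shape_corner.
  by case=> e; move: n1 n2 n3; rewrite e ?ab ?eqxx.
rewrite (bigD1 a1) // (bigD1 b1) /=; last by cell_lia.
rewrite (bigD1 a2) /=; last by cell_lia.
by rewrite big1 ?addn0 ?addnA // => c /andP[/andP[n1 n2] n3]; apply: Z.
Qed.

Lemma nQY_at_a1 m : m <= M -> l2 < l1 -> nQY_at sh a1 m = nQY (diagram l1.-1 l2 h1 h2) m.
Proof.
move=> mM lt; have e : sh :\ a1 = diagram l1.-1 l2 h1 h2.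
  by apply/setP=> x; cell_lia.
rewrite nQY_at_last_col ?e //; first by corner_lia.
  by exists b1; cell_lia.
by move=> x; cell_lia.
Qed.

Lemma nQY_at_b1 m : m < M -> h2 < h1 -> nQY_at sh b1 m.+1 = nQY (diagram l1 l2 h1.-1 h2) m.
Proof.
move=> mM lt; have e : sh :\ b1 = diagram l1 l2 h1.-1 h2.
  by apply/setP=> x; cell_lia.
by rewrite nQY_at_first_col ?e //; corner_lia.
Qed.

Lemma nQY_at_a2 m : m < M -> 2 < l2 ->
  nQY_at sh a2 m.+1 + nQY (diagram l1.-1 l2.-1 h1 h2) m.+1 =
  nQY (diagram l1.-1 l2.-1 h1 h2) m + nQY (diagram l1 l2.-1 h1 h2) m.+1.
Proof.
move=> mM lt; have e : sh :\ a2 = diagram l1 l2.-1 h1 h2.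
  by apply/setP=> x; cell_lia.
have e' : sh :\ a2 :\ a1 = diagram l1.-1 l2.-1 h1 h2.
  by rewrite e; apply/setP=> x; cell_lia.
rewrite -e' -e nQY_at_second_row // ?e' ?e.
- by corner_lia.
- by corner_lia.
- by rewrite a1c a2c; lia.
- by exists b1; cell_lia.
- by move=> x; cell_lia.
- move=> x; rewrite inE => H; have [e1|ne] := eqVneq (x.1 : nat) 0.
    by left; apply: val_inj; rewrite /= e1 a1r.
  by right; lia.
Qed.

Lemma nQY_at_b2 m : m < M -> 2 < h2 ->
  nQY_at sh b2 m.+1 + nQY (diagram l1 l2 h1.-1 h2.-1) m.-1 =
  nQY (diagram l1 l2 h1 h2.-1) m + nQY (diagram l1 l2 h1.-1 h2.-1) m.
Proof.
move=> mM lt; have e : sh :\ b2 = diagram l1 l2 h1 h2.-1.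
  by apply/setP=> x; cell_lia.
have e' : sh :\ b2 :\ b1 = diagram l1 l2 h1.-1 h2.-1.
  by rewrite e; apply/setP=> x; cell_lia.
rewrite -e' -e nQY_at_second_col // ?e' ?e.
- by corner_lia.
- by corner_lia.
- by exists a1; cell_lia.
Qed.

Lemma nQY_at_a2_hook m : m < M -> l2 = 2 -> h2 = 2 ->
  nQY_at sh a2 m.+1 = nQY (diagram l1.-1 0 h1 0) m + nQY (diagram l1 0 h1.-1 0) m.
Proof.
move=> mM l2E h2E; have e : sh :\ a2 = diagram l1 0 h1 0.
  by apply/setP=> x; cell_lia.
have e1 : sh :\ a2 :\ a1 = diagram l1.-1 0 h1 0.
  by rewrite e; apply/setP=> x; cell_lia.
have e2 : sh :\ a2 :\ b1 = diagram l1 0 h1.-1 0.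
  by rewrite e; apply/setP=> x; cell_lia.
rewrite -e1 -e2 (nQY_at_inner (a := a1) (b := b1)) // ?e1 ?e2 ?e.
- by corner_lia.
- by rewrite a2c l2E.
- by corner_lia.
- by rewrite a1c a2c; lia.
- by exists b1; cell_lia.
- by move=> x; cell_lia.
- move=> x; rewrite inE => H; have [e3|ne] := eqVneq (x.1 : nat) 0.
    by left; apply: val_inj; rewrite /= e3 a1r.
  by right; lia.
- by corner_lia.
- by exists a1; cell_lia.
Qed.

(** With equal rows [a2] lies directly above [a1], which is then no corner. The next three lemmas
    treat the other coincidences of lengths likewise. *)
Lemma nQY_at_a1_eq0 m : 0 < m -> l1 = l2 -> nQY_at sh a1 m = 0.
Proof.
move=> m0 lE; apply/eqP/negPn/negP => /nQY_at_corner => /(_ m0)[_ _ /(_ a2)].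
have -> : a2.2 = a1.2 by apply: val_inj; rewrite /= a1c a2c lE.
by rewrite a1r a2r => /(_ _ erefl); apply/implyP; cell_lia.
Qed.

Lemma nQY_at_b1_eq0 m : 0 < m -> h1 = h2 -> nQY_at sh b1 m = 0.
Proof.
move=> m0 hE; apply/eqP/negPn/negP => /nQY_at_corner => /(_ m0)[_ /(_ b2) + _].
have -> : b2.1 = b1.1 by apply: val_inj; rewrite /= b1r b2r hE.
by rewrite b1c b2c => /(_ _ erefl); apply/implyP; cell_lia.
Qed.

Lemma nQY_at_a2_eq0 m : 0 < m -> l2 = 2 -> 2 < h2 -> nQY_at sh a2 m = 0.
Proof.
move=> m0 lE h3; apply/eqP/negPn/negP => /nQY_at_corner => /(_ m0)[_ _ /(_ b2)].
have -> : b2.2 = a2.2 by apply: val_inj; rewrite /= b2c a2c lE.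
by rewrite b2r a2r => /(_ _ erefl); apply/implyP; cell_lia.
Qed.

Lemma nQY_at_b2_eq0 m : 0 < m -> h2 = 2 -> 2 < l2 -> nQY_at sh b2 m = 0.
Proof.
move=> m0 hE l3; apply/eqP/negPn/negP => /nQY_at_corner => /(_ m0)[_ /(_ a2) + _].
have -> : a2.1 = b2.1 by apply: val_inj; rewrite /= b2r a2r hE.
by rewrite b2c a2c => /(_ _ erefl); apply/implyP; cell_lia.
Qed.

End Shape.

(** * Hooks *)

Lemma nQY_set0 m : nQY set0 m = (m == 0).
Proof.
case: m => [|m]; last first.
  apply: eq_card0 => T; rewrite !inE; apply/negP => qT; have /QYP Q := qT.
  by have [//|x ex] := QY_max Q; have := QY_in (x := x) qT; rewrite ex inE => /(_ isT).
rewrite /nQY (_ : [set _ | _] = [set [ffun=> ord0]]) ?cards1 //.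
apply/setP=> T; rewrite !inE; apply/QYP/eqP => [Q|->].
  by apply/ffunP=> x; rewrite ffunE; apply: val_inj; apply: (QY_out Q); rewrite inE.
by split=> [x|x|x|x y|x y||i]; rewrite ?ffunE ?inE // ltn0 andbF.
Qed.

Section Hook.
Variables l h : nat.
Hypotheses (l0 : 0 < l) (lC : l <= C) (h0 : 0 < h) (hR : h <= R).
Variables a b : cell.
Hypotheses (ar : a.1 = 0 :> nat) (ac : a.2 = l.-1 :> nat).
Hypotheses (br : b.1 = h.-1 :> nat) (bc : b.2 = 0 :> nat).
Local Notation hk := (diagram l 0 h 0).

Lemma hook_sum m : 0 < m -> (1 < l) || (1 < h) -> nQY hk m = nQY_at hk a m + nQY_at hk b m.
Proof.
move=> m0 lh; rewrite nQY_sum // (bigD1 a) // (bigD1 b) /=; last by cell_lia.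
rewrite big1 ?addn0 ?addnA // => c /andP[ca cb]; apply/eqP/negPn/negP.
move=> /nQY_at_corner => /(_ m0)[cS cR cC].
have [aS bS] : a \in hk /\ b \in hk by split; cell_lia.
move: cS ca cb; rewrite inE !cell_eqE => /or4P[] /andP[/eqP e lt] //.
- have e1 : a.1 = c.1 by apply: val_inj; rewrite /= ar e.
  by have := cR _ aS e1; lia.
- have e1 : b.2 = c.2 by apply: val_inj; rewrite /= bc e.
  by have := cC _ bS e1; lia.
Qed.

Lemma nQY_at_hook_arm m : m <= M -> 0 < m -> (1 < l) || (1 < h) ->
  nQY_at hk a m = if 1 < l then nQY (diagram l.-1 0 h 0) m else 0.
Proof.
move=> mM m0 lh; case: ifPn => l1.
  have e : hk :\ a = diagram l.-1 0 h 0 by apply/setP=> x; cell_lia.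
  rewrite nQY_at_last_col ?e //; first by corner_lia.
    by exists b; cell_lia.
  by move=> x; cell_lia.
apply/eqP/negPn/negP => /nQY_at_corner => /(_ m0)[_ _ /(_ b)].
have -> : b.2 = a.2 by apply: val_inj; rewrite /= ac bc; lia.
by rewrite ar br => /(_ _ erefl); apply/implyP; cell_lia.
Qed.

Lemma nQY_at_hook_leg m : m < M -> (1 < l) || (1 < h) ->
  nQY_at hk b m.+1 = if 1 < h then nQY (diagram l 0 h.-1 0) m else 0.
Proof.
move=> mM lh; case: ifPn => h1.
  have e : hk :\ b = diagram l 0 h.-1 0 by apply/setP=> x; cell_lia.
  by rewrite nQY_at_first_col ?e //; corner_lia.
apply/eqP/negPn/negP => /nQY_at_corner => /(_ isT)[_ /(_ a) + _].
have -> : a.1 = b.1 by apply: val_inj; rewrite /= ar br; lia.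
by rewrite ac bc => /(_ _ erefl); apply/implyP; cell_lia.
Qed.

Lemma nQY_box m : m <= M -> l = 1 -> h = 1 -> nQY hk m = (m == 1).
Proof.
move=> mM lE hE; case: m mM => [|m] mM; first by apply: nQY_zero => //; exists a; cell_lia.
have e : hk :\ a = set0 by apply/setP=> x; cell_lia.
rewrite nQY_sum // (bigD1 a) //= big1 => [|c ca].
  rewrite addn0 nQY_at_first_col ?e ?nQY_set0 ?eqSS //; last by rewrite ac lE.
  by corner_lia.
apply/eqP/negPn/negP => /nQY_at_corner => /(_ isT)[cS _ _].
by move: cS ca; cell_lia.
Qed.

End Hook.

(** Erasing the end of the arm keeps the maximum and erasing the end of the leg lowers it by one, so
    the maximum is the height and the counts obey Pascal's rule. *)
Lemma nQY_hook l h m : 0 < l -> l <= C -> 0 < h -> h <= R -> m <= M ->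
  nQY (diagram l 0 h 0) m = if m == h then 'C(l + h - 2, h.-1) else 0.
Proof.
have [N] := ubnP (l + h); elim: N l h m => // N IH l h m lhN l0 lC h0 hR mM.
have R0 : 0 < R by lia. have C0 : 0 < C by lia.
have Rh : h.-1 < R by lia. have Cl : l.-1 < C by lia.
pose a : cell := (Ordinal R0, Ordinal Cl); pose b : cell := (Ordinal Rh, Ordinal C0).
have [lh|] := boolP ((1 < l) || (1 < h)); last first.
  rewrite negb_or -!leqNgt => /andP[l1 h1].
  have lE : l = 1 by lia. have hE : h = 1 by lia.
  by rewrite (@nQY_box l h _ _ _ _ a b) // lE hE; case: (m == 1).
case: m mM => [|m] mM.
  rewrite nQY_zero //; last by exists a; rewrite inE /=; lia.
  by case: eqP => // hE; move: h0; rewrite -hE.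
rewrite (@hook_sum l h _ _ _ _ a b) // (@nQY_at_hook_arm l h _ _ _ _ a b) //.
rewrite (@nQY_at_hook_leg l h _ _ _ _ a b) //.
case: l h {a b Rh Cl} l0 h0 lC hR lhN lh => // -[|l] [//|[|h]] _ _ lC hR lhN lh //=.
- rewrite IH //; try lia.
  by rewrite eqSS add0n; case: eqP => // _; rewrite !add1n !subSS !subn0 !binn.
- rewrite IH //; try lia.
  by rewrite !addn1 addn0 !bin0.
- rewrite !IH //; try lia.
  rewrite !eqSS; case: eqP => // _.
  rewrite !addSn !addnS !subSS subn0 /= [in RHS]binS addnC; congr (_ + _).
Qed.

End Tableaux.

(** * The closed formula and its recurrences *)

Local Open Scope ring_scope.

(* Factorials of integers: [facz x = |x|!] is used at [x >= 0] only, while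
   [invfz x = 1 / x!] is extended by [0] to [x < 0], like the reciprocal Gamma function. *)
Definition facz (x : int) : rat := (`|x|%N)`!%:R.
Definition invfz (x : int) : rat := if 0 <= x then (facz x)^-1 else 0.

Lemma facz_pred (x : int) : 0 < x -> facz x = x%:~R * facz (x - 1).
Proof.
case: x => // -[//|n] _; rewrite /facz.
have -> : Posz n.+1 - 1 = n by lia.
by rewrite /= factS natrM.
Qed.

Lemma facz_neq0 (x : int) : facz x != 0.
Proof. by rewrite /facz pnatr_eq0 -lt0n fact_gt0. Qed.

(** The extension by zero makes this valid for every integer, so boundary cases of the recurrence
    need no separate treatment of these factors. *)
Lemma invfz_pred (x : int) : invfz (x - 1) = x%:~R * invfz x.
Proof.
rewrite /invfz; have [x0|x0|->] := ltgtP x 0.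
- have -> : (0 <= x - 1) = false by lia.
  by rewrite mulr0.
- have -> : (0 <= x - 1) = true by lia.
  rewrite (facz_pred x0) invfM mulVKf // intr_eq0; lia.
- by rewrite mul0r.
Qed.

Lemma invfz_neg (x : int) : x < 0 -> invfz x = 0.
Proof. by rewrite /invfz leNgt => ->. Qed.

(* With [d = m - 1] descents and [e = n - 1 - d] ascents, the last four factors are
   [1 / ((d - b1)! (d - b2)! (e - a1)! (e - a2)!)], [(a1, a2 | b1, b2)] being
   the Frobenius coordinates. *)
Definition frob_count (a1 a2 b1 b2 m : int) : rat :=
  (a1 - a2)%:~R * (b1 - b2)%:~R *
  (facz (a1 + b1) * facz (a1 + b2) * facz (a2 + b1) * facz (a2 + b2)) *
  (invfz a1 * invfz a2 * invfz b1 * invfz b2) *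
  (invfz (m - 1 - b1) * invfz (m - 1 - b2)) *
  (invfz (a2 + b1 + b2 + 2 - m) * invfz (a1 + b1 + b2 + 2 - m)).

(** Once the shifted arguments are normalised, every term is a polynomial multiple of one common
    product, and a polynomial identity remains. Positive sums are required because the rule
    [facz_pred] fails at 0. *)
Lemma frob_count_rec (a1 a2 b1 b2 m : int) :
  0 < a1 + b1 -> 0 < a1 + b2 -> 0 < a2 + b1 -> 0 < a2 + b2 ->
  frob_count a1 a2 b1 b2 m =
    frob_count (a1 - 1) a2 b1 b2 m + frob_count a1 a2 (b1 - 1) b2 (m - 1) +
    (frob_count a1 a2 b1 (b2 - 1) (m - 1) +
     frob_count a1 a2 (b1 - 1) (b2 - 1) (m - 1) -
     frob_count a1 a2 (b1 - 1) (b2 - 1) (m - 2)) +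
    (frob_count a1 (a2 - 1) b1 b2 m - frob_count (a1 - 1) (a2 - 1) b1 b2 m +
     frob_count (a1 - 1) (a2 - 1) b1 b2 (m - 1)).
Proof.
move=> p11 p12 p21 p22; rewrite /frob_count.
have -> : a1 - 1 + b1 = a1 + b1 - 1 by lia.
have -> : a1 - 1 + b2 = a1 + b2 - 1 by lia.
have -> : a2 - 1 + b1 = a2 + b1 - 1 by lia.
have -> : a2 - 1 + b2 = a2 + b2 - 1 by lia.
have -> : a1 + (b1 - 1) = a1 + b1 - 1 by lia.
have -> : a1 + (b2 - 1) = a1 + b2 - 1 by lia.
have -> : a2 + (b1 - 1) = a2 + b1 - 1 by lia.
have -> : a2 + (b2 - 1) = a2 + b2 - 1 by lia.
have -> : a1 + b1 - 1 + b2 + 2 - m = (a1 + b1 + b2 + 2 - m) - 1 by lia.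
have -> : a2 + b1 - 1 + b2 + 2 - m = (a2 + b1 + b2 + 2 - m) - 1 by lia.
have -> : m - 1 - 1 - (b1 - 1) = m - 1 - b1 by lia.
have -> : m - 1 - 1 - b2 = (m - 1 - b2) - 1 by lia.
have -> : m - 1 - 1 - b1 = (m - 1 - b1) - 1 by lia.
have -> : m - 1 - 1 - (b2 - 1) = m - 1 - b2 by lia.
have -> : m - 2 - 1 - (b1 - 1) = (m - 1 - b1) - 1 by lia.
have -> : m - 2 - 1 - (b2 - 1) = (m - 1 - b2) - 1 by lia.
have -> : a1 + b1 - 1 + b2 + 2 - (m - 1) = a1 + b1 + b2 + 2 - m by lia.
have -> : a2 + b1 - 1 + b2 + 2 - (m - 1) = a2 + b1 + b2 + 2 - m by lia.
have -> : a1 + b1 + (b2 - 1) + 2 - (m - 1) = a1 + b1 + b2 + 2 - m by lia.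
have -> : a2 + b1 + (b2 - 1) + 2 - (m - 1) = a2 + b1 + b2 + 2 - m by lia.
have -> : a1 + b1 - 1 + (b2 - 1) + 2 - (m - 1) = a1 + b1 + b2 + 2 - m - 1 by lia.
have -> : a2 + b1 - 1 + (b2 - 1) + 2 - (m - 1) = a2 + b1 + b2 + 2 - m - 1 by lia.
have -> : a1 + b1 - 1 + (b2 - 1) + 2 - (m - 2) = a1 + b1 + b2 + 2 - m by lia.
have -> : a2 + b1 - 1 + (b2 - 1) + 2 - (m - 2) = a2 + b1 + b2 + 2 - m by lia.
rewrite !invfz_pred (facz_pred p11) (facz_pred p12) (facz_pred p21) (facz_pred p22).
ring.
Qed.

Lemma invfzE (n : nat) : invfz n = (n`!%:R)^-1.
Proof. by []. Qed.

Lemma fact_neq0 (n : nat) : n`!%:R != 0 :> rat.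
Proof. by rewrite pnatr_eq0 -lt0n fact_gt0. Qed.

Lemma facz_invfz (x : int) : 0 <= x -> facz x * invfz x = 1.
Proof. by rewrite /invfz => ->; rewrite divff // facz_neq0. Qed.

Lemma natr_bin (n k : nat) : (k <= n)%N ->
  'C(n, k)%:R = n`!%:R / (k`!%:R * (n - k)`!%:R) :> rat.
Proof.
by move=> kn; rewrite -(bin_fact kn) !natrM mulfK // mulf_neq0 // fact_neq0.
Qed.

Lemma frob_count_a_eq a1 a2 b1 b2 m : a1 = a2 -> frob_count a1 a2 b1 b2 m = 0.
Proof. by move=> ->; rewrite /frob_count subrr !mul0r. Qed.

Lemma frob_count_b_eq a1 a2 b1 b2 m : b1 = b2 -> frob_count a1 a2 b1 b2 m = 0.
Proof. by move=> ->; rewrite /frob_count subrr mulr0 !mul0r. Qed.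

Lemma frob_count_a2_neg a1 a2 b1 b2 m : a2 < 0 -> frob_count a1 a2 b1 b2 m = 0.
Proof. by move=> /invfz_neg e; rewrite /frob_count e; ring. Qed.

Lemma frob_count_b2_neg a1 a2 b1 b2 m : b2 < 0 -> frob_count a1 a2 b1 b2 m = 0.
Proof. by move=> /invfz_neg e; rewrite /frob_count e; ring. Qed.

Lemma frob_count_small a1 a2 b1 b2 m : m <= b1 -> frob_count a1 a2 b1 b2 m = 0.
Proof.
move=> mb; have /invfz_neg e : m - 1 - b1 < 0 by lia.
by rewrite /frob_count e; ring.
Qed.

(** For [a2 = b2 = 0] the terms of the inner corner are replaced by the counts of the two hooks left
    after erasing it and one further end. Everything vanishes unless [m] is [b] or [b.+1]. *)
Lemma frob_count_rec_hook (a b m : nat) : (0 < a)%N -> (0 < b)%N ->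
  frob_count a 0 b 0 m.+1 =
    frob_count (a%:Z - 1) 0 b 0 m.+1 + frob_count a 0 (b%:Z - 1) 0 m +
    ((if m == b.+1 then 'C(a + b - 1, b) else 0)%N%:R +
     (if m == b then 'C(a + b - 1, b.-1) else 0)%N%:R).
Proof.
move=> a0 b0; rewrite /frob_count !addr0 !add0r ?subr0.
have -> : a%:Z - 1 + b = a%:Z + b - 1 by lia.
have -> : a%:Z + (b%:Z - 1) = a%:Z + b - 1 by lia.
have ab0 : 0 < a%:Z + b by lia.
have fa : facz (a%:Z - 1) * invfz (a%:Z - 1) = 1 by apply: facz_invfz; lia.
have fb : facz (b%:Z - 1) * invfz (b%:Z - 1) = 1 by apply: facz_invfz; lia.
have fa' : facz a * invfz a = 1 by apply: facz_invfz.
have fb' : facz b * invfz b = 1 by apply: facz_invfz.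
have i0 : invfz 0 = 1 by [].
have i1 : invfz 1 = 1 by [].
have z0 : facz 0 = 1 by [].
have [mb|mb] := ltnP m b.
  rewrite !(@invfz_neg (m.+1%:Z - 1 - b%:Z)); try lia.
  rewrite !(@invfz_neg (m%:Z - 1 - (b%:Z - 1))); try lia.
  by rewrite !ifN; [ring | lia | lia].
have [mb'|mb'] := ltnP b.+1 m.
  rewrite !(@invfz_neg (b%:Z + 2 - m.+1%:Z)); try lia.
  rewrite !(@invfz_neg (b%:Z - 1 + 2 - m%:Z)); try lia.
  by rewrite !ifN; [ring | lia | lia].
have eP : ('C(a + b - 1, b))%:R = facz (a%:Z + b - 1) * (invfz b * invfz (a%:Z - 1)).
  rewrite natr_bin ?invfM; last by lia.
  have -> : a%:Z - 1 = (a + b - 1 - b)%N by lia.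
  by have -> : a%:Z + b - 1 = (a + b - 1)%N by lia.
have eQ : ('C(a + b - 1, b.-1))%:R = facz (a%:Z + b - 1) * (invfz (b%:Z - 1) * invfz a).
  rewrite natr_bin ?invfM; last by lia.
  have -> : b%:Z - 1 = b.-1 by lia.
  have -> : invfz a = invfz (a + b - 1 - b.-1)%N by congr invfz; lia.
  by have -> : a%:Z + b - 1 = (a + b - 1)%N by lia.
rewrite (facz_pred ab0) z0 i0.
have [mE|mE] : m = b \/ m = b.+1 by lia.
  rewrite mE eqxx ifN ?eQ; last by lia.
  have -> : b.+1%:Z - 1 - b%:Z = 0 by lia.
  have -> : b.+1%:Z - 1 = b by lia.
  have -> : b%:Z + 2 - b.+1%:Z = 1 by lia.
  have -> : a%:Z + b + 2 - b.+1%:Z = a%:Z + 1 by lia.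
  have -> : a%:Z + b - 1 + 2 - b.+1%:Z = a%:Z + 1 - 1 by lia.
  have -> : b%:Z - 1 - (b%:Z - 1) = 0 by lia.
  have -> : b%:Z - 1 + 2 - b%:Z = 1 by lia.
  have -> : a%:Z + b - 1 + 2 - b%:Z = a%:Z + 1 by lia.
  rewrite i0 i1.
  (* The regrouping pairs each factorial with its reciprocal, whose cancellation [ring] cannot
     see. *)
  transitivity (a%:~R * b%:~R * ((a%:Z + b)%:~R * facz (a%:Z + b - 1)) *
     (facz a * invfz a) * (facz b * invfz b) * (invfz b * invfz (a%:Z + 1)) : rat).
    by ring.
  rewrite fa' fb'.
  transitivity ((a%:Z - 1)%:~R * b%:~R * facz (a%:Z + b - 1) *
     (facz (a%:Z - 1) * invfz (a%:Z - 1)) * (facz b * invfz b) * (invfz b * invfz (a%:Z + 1 - 1))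
   + a%:~R * (b%:Z - 1)%:~R * facz (a%:Z + b - 1) *
     (facz a * invfz a) * (facz (b%:Z - 1) * invfz (b%:Z - 1)) * (invfz (b%:Z - 1) * invfz (a%:Z + 1))
    + facz (a%:Z + b - 1) * (invfz (b%:Z - 1) * invfz a) : rat); last by ring.
  rewrite fa fb fa' fb'.
  have -> : invfz a = (a%:Z + 1)%:~R * invfz (a%:Z + 1).
    by rewrite -invfz_pred; congr invfz; lia.
  rewrite !invfz_pred; ring.
rewrite mE eqxx ifN ?eP; last by lia.
have -> : b.+2%:Z - 1 - b%:Z = 1 by lia.
have -> : b.+2%:Z - 1 = b%:Z + 1 by lia.
have -> : b.+1%:Z - 1 = b by lia.
have -> : b%:Z + 2 - b.+2%:Z = 0 by lia.
have -> : a%:Z + b + 2 - b.+2%:Z = a by lia.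
have -> : a%:Z + b - 1 + 2 - b.+2%:Z = a%:Z - 1 by lia.
have -> : b%:Z - (b%:Z - 1) = 1 by lia.
have -> : b%:Z - 1 + 2 - b.+1%:Z = 0 by lia.
have -> : a%:Z + b - 1 + 2 - b.+1%:Z = a by lia.
rewrite i0 i1.
transitivity (a%:~R * b%:~R * ((a%:Z + b)%:~R * facz (a%:Z + b - 1)) *
   (facz a * invfz a) * (facz b * invfz b) * (invfz (b%:Z + 1) * invfz a) : rat).
  by ring.
rewrite fa' fb'.
transitivity ((a%:Z - 1)%:~R * b%:~R * facz (a%:Z + b - 1) *
   (facz (a%:Z - 1) * invfz (a%:Z - 1)) * (facz b * invfz b) * (invfz (b%:Z + 1) * invfz (a%:Z - 1))
 + a%:~R * (b%:Z - 1)%:~R * facz (a%:Z + b - 1) *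
   (facz a * invfz a) * (facz (b%:Z - 1) * invfz (b%:Z - 1)) * (invfz b * invfz a)
  + facz (a%:Z + b - 1) * (invfz b * invfz (a%:Z - 1)) : rat); last by ring.
rewrite fa fb fa' fb'.
have -> : invfz b = (b%:Z + 1)%:~R * invfz (b%:Z + 1).
  by rewrite -invfz_pred; congr invfz; lia.
rewrite !invfz_pred; ring.
Qed.

(** * Solution of the recurrence *)

(** Induction on the sum of the four lengths. Where an end is no corner, the formula vanishes too:
    through [a1 - a2] or [b1 - b2] for equal lengths, and through the reciprocal factorial of a
    negative [a2] or [b2] for length 2. *)
Lemma nQY_diagram (R C M l1 l2 h1 h2 m : nat) :
  (2 <= l2)%N -> (l2 <= l1)%N -> (l1 <= C)%N ->
  (2 <= h2)%N -> (h2 <= h1)%N -> (h1 <= R)%N -> (m <= M)%N ->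
  (nQY M (@diagram R C l1 l2 h1 h2) m)%:R =
    frob_count (l1%:Z - 1) (l2%:Z - 2) (h1%:Z - 1) (h2%:Z - 2) m.
Proof.
have [N] := ubnP (l1 + l2 + h1 + h2).
elim: N l1 l2 h1 h2 m => // N IH l1 l2 h1 h2 m lhN l22 l21 l1C h22 h21 h1R mM.
have R0 : (0 < R)%N by lia. have R1 : (1 < R)%N by lia.
have C0 : (0 < C)%N by lia. have C1 : (1 < C)%N by lia.
have Rh1 : (h1.-1 < R)%N by lia. have Rh2 : (h2.-1 < R)%N by lia.
have Cl1 : (l1.-1 < C)%N by lia. have Cl2 : (l2.-1 < C)%N by lia.
pose a1 : 'I_R * 'I_C := (Ordinal R0, Ordinal Cl1).
pose a2 : 'I_R * 'I_C := (Ordinal R1, Ordinal Cl2).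
pose b1 : 'I_R * 'I_C := (Ordinal Rh1, Ordinal C0).
pose b2 : 'I_R * 'I_C := (Ordinal Rh2, Ordinal C1).
case: m mM => [|m] mM.
  rewrite nQY_zero //; last by exists a1; rewrite inE /=; lia.
  by rewrite frob_count_small //; lia.
have mM' : (m <= M)%N by apply: ltnW.
have eP1 n : (0 < n)%N -> n%:Z - 1 - 1 = n.-1%:Z - 1 by lia.
have eP2 n : (0 < n)%N -> n%:Z - 2 - 1 = n.-1%:Z - 2 by lia.
have em1 : m.+1%:Z - 1 = m by lia.
have Ea1 : (nQY_at M (@diagram R C l1 l2 h1 h2) a1 m.+1)%:R =
    frob_count (l1%:Z - 1 - 1) (l2%:Z - 2) (h1%:Z - 1) (h2%:Z - 2) m.+1.
  have [lt|ge] := ltnP l2 l1.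
    rewrite (@nQY_at_a1 R C M l1 l2 h1 h2 _ _ _ _ _ _ a1 a2 b1 b2) // IH; try lia.
    by rewrite eP1 //; lia.
  rewrite (@nQY_at_a1_eq0 R C M l1 l2 h1 h2 _ _ _ _ _ _ a1 a2 b1 b2) //; last by lia.
  by rewrite frob_count_a_eq //; lia.
have Eb1 : (nQY_at M (@diagram R C l1 l2 h1 h2) b1 m.+1)%:R =
    frob_count (l1%:Z - 1) (l2%:Z - 2) (h1%:Z - 1 - 1) (h2%:Z - 2) (m.+1%:Z - 1).
  have [lt|ge] := ltnP h2 h1.
    rewrite (@nQY_at_b1 R C M l1 l2 h1 h2 _ _ _ _ _ _ a1 a2 b1 b2) // IH; try lia.
    by rewrite eP1 ?em1 //; lia.
  rewrite (@nQY_at_b1_eq0 R C M l1 l2 h1 h2 _ _ _ _ _ _ a1 a2 b1 b2) //; last by lia.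
  by rewrite frob_count_b_eq //; lia.
have [lh|] := boolP ((2 < l2) || (2 < h2))%N; last first.
  rewrite negb_or -!leqNgt => /andP[l2le h2le].
  have l2E : l2 = 2%N by lia. have h2E : h2 = 2%N by lia.
  rewrite (@shape_sum22 R C M l1 l2 h1 h2 _ _ _ _ _ _ a1 a2 b1 b2) //.
  rewrite (@nQY_at_a2_hook R C M l1 l2 h1 h2 _ _ _ _ _ _ a1 a2 b1 b2) //.
  rewrite !natrD Ea1 Eb1 !nQY_hook //; try lia.
  rewrite l2E h2E subrr em1.
  have -> : l1%:Z - 1 = l1.-1 by lia.
  have -> : h1%:Z - 1 = h1.-1 by lia.
  rewrite frob_count_rec_hook; try lia.
  have -> : (l1.-1 + h1 - 2 = l1.-1 + h1.-1 - 1)%N by lia.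
  have -> : (l1 + h1.-1 - 2 = l1.-1 + h1.-1 - 1)%N by lia.
  by rewrite prednK //; lia.
have Ea2 : (nQY_at M (@diagram R C l1 l2 h1 h2) a2 m.+1)%:R =
    frob_count (l1%:Z - 1) (l2%:Z - 2 - 1) (h1%:Z - 1) (h2%:Z - 2) m.+1 -
    frob_count (l1%:Z - 1 - 1) (l2%:Z - 2 - 1) (h1%:Z - 1) (h2%:Z - 2) m.+1 +
    frob_count (l1%:Z - 1 - 1) (l2%:Z - 2 - 1) (h1%:Z - 1) (h2%:Z - 2) (m.+1%:Z - 1).
  have [l3|l3] := ltnP 2 l2.
    have := @nQY_at_a2 R C M l1 l2 h1 h2 l22 l21 l1C h22 h21 h1R a1 a2 b1 b2
      erefl erefl erefl erefl erefl erefl erefl erefl m mM l3.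
    move=> /(congr1 (fun n : nat => n%:R : rat)); rewrite !natrD.
    rewrite eP1 ?eP2 ?em1; try lia.
    rewrite -!IH; try lia.
    by move=> e; rewrite -[LHS](addrK (nQY M (diagram R C l1.-1 l2.-1 h1 h2) m.+1)%:R) e; ring.
  rewrite (@nQY_at_a2_eq0 R C M l1 l2 h1 h2 _ _ _ _ _ _ a1 a2 b1 b2) //; try lia.
  by rewrite !frob_count_a2_neg; [ring | lia | lia | lia].
have Eb2 : (nQY_at M (@diagram R C l1 l2 h1 h2) b2 m.+1)%:R =
    frob_count (l1%:Z - 1) (l2%:Z - 2) (h1%:Z - 1) (h2%:Z - 2 - 1) (m.+1%:Z - 1) +
    frob_count (l1%:Z - 1) (l2%:Z - 2) (h1%:Z - 1 - 1) (h2%:Z - 2 - 1) (m.+1%:Z - 1) -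
    frob_count (l1%:Z - 1) (l2%:Z - 2) (h1%:Z - 1 - 1) (h2%:Z - 2 - 1) (m.+1%:Z - 2).
  have [h3|h3] := ltnP 2 h2.
    have := @nQY_at_b2 R C M l1 l2 h1 h2 l22 l21 l1C h22 h21 h1R a1 a2 b1 b2
      erefl erefl erefl erefl erefl erefl erefl erefl m mM h3.
    move=> /(congr1 (fun n : nat => n%:R : rat)); rewrite !natrD.
    rewrite eP1 ?eP2 ?em1; try lia.
    (* The truncated [m.-1] differs from the integer [m - 1] only at [m = 0], where both values of
       the formula are zero. *)
    have -> : frob_count (l1%:Z - 1) (l2%:Z - 2) (h1.-1%:Z - 1) (h2.-1%:Z - 2) (m.+1%:Z - 2) =
              frob_count (l1%:Z - 1) (l2%:Z - 2) (h1.-1%:Z - 1) (h2.-1%:Z - 2) m.-1.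
      have [m0|m0] := posnP m; last by congr frob_count; lia.
      by rewrite !frob_count_small //; lia.
    rewrite -!IH; try lia.
    by move=> e; rewrite -[LHS](addrK (nQY M (diagram R C l1 l2 h1.-1 h2.-1) m.-1)%:R) e; ring.
  rewrite (@nQY_at_b2_eq0 R C M l1 l2 h1 h2 _ _ _ _ _ _ a1 a2 b1 b2) //; try lia.
  by rewrite !frob_count_b2_neg; [ring | lia | lia | lia].
rewrite (@shape_sum R C M l1 l2 h1 h2 _ _ _ _ _ _ a1 a2 b1 b2) // !natrD.
by rewrite Ea1 Ea2 Eb1 Eb2 [RHS]frob_count_rec; [ring | lia | lia | lia | lia].
Qed.

(** * Passage to the tableaux and binomials of the statement *)

Lemma size_hook2 l1 l2 h1 h2 : (2 <= h2)%N -> (h2 <= h1)%N ->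
  size (hook2 l1 l2 h1 h2) = h1.
Proof. by move=> ? ?; rewrite /hook2 /= size_cat !size_nseq; lia. Qed.

Lemma in_shape_hook2 l1 l2 h1 h2 i j :
  (2 <= l2)%N -> (l2 <= l1)%N -> (2 <= h2)%N -> (h2 <= h1)%N ->
  in_shape (hook2 l1 l2 h1 h2) i j =
    [|| (i == 0%N) && (j < l1)%N, (i == 1%N) && (j < l2)%N,
        (j == 0%N) && (i < h1)%N | (j == 1%N) && (i < h2)%N].
Proof.
move=> l22 l21 h22 h21; rewrite /in_shape size_hook2 //.
case: i => [|[|i]] /=; [lia | lia |].
rewrite nth_cat !nth_nseq size_nseq.
by case: ifP => H1; case: ifP => H2; lia.
Qed.

(** The original condition concerns only values that appear, but each appearing [i > 1] forces
    [i - 1], so descending from [m] all values appear. Conversely, the leftmost [i] inherits the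
    link of any other occurrence. *)
Lemma is_QYT_eqE lam m (T : filling lam m)
    (S : {set 'I_(size lam) * 'I_(head 0 lam)}) :
  (forall x, ins x = (x \in S)) -> (0 < m)%N -> is_QYT_eq T = QY S m T.
Proof.
move=> insE m0; apply/idP/QYP.
  case/and5P=> /forallP H1 /forallP H2 /forallP H3 /forallP H4 /andP[/existsP H5 /forallP H6].
  split.
  - by move=> x xS; apply/eqP; have /implyP := H1 x; apply; rewrite insE.
  - by move=> x xS; have /implyP := H2 x; apply; rewrite insE.
  - by move=> x; rewrite -ltnS ltn_ord.
  - move=> x y xS yS e l; have /forallP/(_ y)/implyP := H3 x; apply.
    by rewrite !insE xS yS e eqxx.
  - move=> x y xS yS e l; have /forallP/(_ y)/implyP := H4 x; apply.
    by rewrite !insE xS yS e eqxx.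
  - by move=> _; case: H5 => x /andP[_ /eqP]; exists x.
  - have down x : ins x -> (1 < T x)%N -> exists x' z,
        [/\ ins z, T x' = T x, T z = (T x).-1 :> nat & (x'.2 <= z.2)%N].
      move=> xi x1; have /implyP := H6 (T x); rewrite x1 /=.
      have -> : [exists y, ins y && (T y == T x)] by apply/existsP; exists x; rewrite xi eqxx.
      move=> /(_ isT)/existsP[x' /and4P[_ /eqP e _ /existsP[z /and3P[zi /eqP ez l]]]].
      by exists x', z.
    have occ k : (k < m)%N -> exists2 x, ins x & T x = (m - k)%N :> nat.
      elim: k => [_|k IH km].
        by case: H5 => x /andP[xi /eqP e]; exists x; rewrite ?subn0.
      have [x xi ex] := IH (ltnW km).
      have [|x' [z [zi _ ez _]]] := down x xi; first by rewrite ex; lia.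
      by exists z; rewrite // ez ex; lia.
    move=> i /andP[i0 im]; have [|x xi ex] := occ (m - i.+1)%N; first by lia.
    have [|x' [z [zi ex' ez l]]] := down x xi; first by rewrite ex; lia.
    by exists x', z; rewrite ex' ez ex; split=> //; lia.
case=> H1 H2 H3 H4 H5 H6 H7.
have insT x : (0 < T x)%N -> ins x by apply: contraLR; rewrite insE => /H1 ->.
apply/and5P; split.
- by apply/forallP=> x; apply/implyP; rewrite insE => /H1 ->.
- by apply/forallP=> x; apply/implyP; rewrite insE => /H2.
- apply/forallP=> x; apply/forallP=> y; apply/implyP.
  by rewrite !insE => /and4P[xS yS /eqP e l]; apply: H4.
- apply/forallP=> x; apply/forallP=> y; apply/implyP.
  by rewrite !insE => /and4P[xS yS /eqP e l]; apply: H5.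
apply/andP; split.
  by have [x ex] := H6 m0; apply/existsP; exists x; rewrite insT ex ?eqxx.
apply/forallP=> i; apply/implyP=> /andP[i1 _].
have [|x0 [z [ex0 ez l]]] := H7 i.-1; first by have := ltn_ord i; lia.
have P0 : ins x0 && (T x0 == i).
  by rewrite insT ?ex0 //=; apply/eqP/val_inj; rewrite /= ex0; lia.
(* The leftmost occurrence is weakly left of [x0], hence also of [z]. *)
have [x /andP[xi ex] xmin] := @arg_minnP _ x0 (fun x => ins x && (T x == i)) (fun x => x.2) P0.
apply/existsP; exists x; rewrite xi ex /=; apply/andP; split.
  by apply/forallP=> y; apply/implyP=> /xmin.
apply/existsP; exists z; rewrite insT ?ez ?eqxx /=; last by lia.
by apply: leq_trans l; apply: xmin.
Qed.

Lemma QYT_eq_cardE l1 l2 h1 h2 m : (2 <= l2)%N -> (l2 <= l1)%N ->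
  (2 <= h2)%N -> (h2 <= h1)%N -> (0 < m)%N ->
  (QYT_eq_card (hook2 l1 l2 h1 h2) m)%:R =
    frob_count (l1%:Z - 1) (l2%:Z - 2) (h1%:Z - 1) (h2%:Z - 2) m.
Proof.
move=> l22 l21 h22 h21 m0; set lam := hook2 _ _ _ _.
have h1R : (h1 <= size lam)%N by rewrite size_hook2.
rewrite -(@nQY_diagram (size lam) (head 0%N lam) m) //.
congr (_%:R); apply: eq_card => T; rewrite !inE; apply: is_QYT_eqE => // x.
by rewrite /ins in_shape_hook2 // inE.
Qed.

(** In the product of binomials, [(b1 - b2)!] over [(b1 - b2 - 1)!] leaves the factor [b1 - b2], and
    the denominator [m - b2 - 1] completes [(m - b2 - 2)!] to [(m - 1 - b2)!]. *)
Lemma frob_count_binomial (a1 a2 b1 b2 m : nat) :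
  (a2 <= a1)%N -> (b2 < b1)%N -> (b1 < m)%N -> (m <= a2 + b1 + b2 + 2)%N ->
  frob_count a1 a2 b1 b2 m =
    (a1 - a2)%:R / (m - b2.+1)%:R * 'C(a1 + b1, m - b2.+2)%:R *
    'C(a2 + b1, m - b2.+2)%:R * 'C(m - b2.+2, m - b1.+1)%:R *
    'C(a2 + b2, b2)%:R * 'C(a1 + b2, b2)%:R / 'C(b1, b2)%:R.
Proof.
move=> a21 b21 b1m ma; rewrite !natr_bin; try lia.
rewrite /frob_count.
have -> : a1%:Z - a2%:Z = (a1 - a2)%N by lia.
have -> : b1%:Z - b2%:Z = (b1 - b2)%N by lia.
have -> : m%:Z - 1 - b1%:Z = (m - b1.+1)%N by lia.
have -> : m%:Z - 1 - b2%:Z = (m - b2.+2).+1 by lia.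
have -> : a2%:Z + b1 + b2 + 2 - m%:Z = (a2 + b1 - (m - b2.+2))%N by lia.
have -> : a1%:Z + b1 + b2 + 2 - m%:Z = (a1 + b1 - (m - b2.+2))%N by lia.
have -> : (m - b2.+2 - (m - b1.+1) = b1 - b2.+1)%N by lia.
rewrite !addnK !invfzE -!PoszD /facz !absz_nat -!pmulrn.
have -> : (b1 - b2 = (b1 - b2.+1).+1)%N by lia.
have -> : (m - b2.+1 = (m - b2.+2).+1)%N by lia.
rewrite !factS !natrM.
field.
by rewrite !fact_neq0 !nat1r !pnatr_eq0.
Qed.

Theorem theorem4p1 (l1 l2 h1 h2 m : nat) :
  (l1 >= l2)%N -> (l2 >= 2)%N -> (h1 >= h2)%N -> (h2 >= 2)%N ->
  (h1 <= m)%N -> (m <= (l1 + l2 + h1 + h2 - 4) - (l1 - 1))%N ->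
  (QYT_eq_card (hook2 l1 l2 h1 h2) m)%:R =
    ((l1 - l2 + 1)%:R / (m - h2 + 1)%:R) *
    ('C(l1 + h1 - 2, m - h2))%:R * ('C(l2 + h1 - 3, m - h2))%:R *
    ('C(m - h2, m - h1))%:R * ('C(l2 + h2 - 4, h2 - 2))%:R *
    ('C(l1 + h2 - 3, h2 - 2))%:R / ('C(h1 - 1, h2 - 2))%:R :> rat.
Proof.
move=> l21 l22 h21 h22 h1m mn; rewrite QYT_eq_cardE //; last by lia.
pose a1 := (l1 - 1)%N; pose a2 := (l2 - 2)%N.
pose b1 := (h1 - 1)%N; pose b2 := (h2 - 2)%N.
have l1E : l1 = a1.+1 by rewrite /a1; lia.
have l2E : l2 = a2.+2 by rewrite /a2; lia.
have h1E : h1 = b1.+1 by rewrite /b1; lia.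
have h2E : h2 = b2.+2 by rewrite /b2; lia.
move: a1 a2 b1 b2 l1E l2E h1E h2E => a1 a2 b1 b2 l1E l2E h1E h2E; subst.
have -> : a1.+1%:Z - 1 = a1 by lia.
have -> : a2.+2%:Z - 2 = a2 by lia.
have -> : b1.+1%:Z - 1 = b1 by lia.
have -> : b2.+2%:Z - 2 = b2 by lia.
(* In these coordinates the bounds on [m] read [b1 < m] and [m <= a2 + b1 + b2 + 2], which keep
   every binomial in range. *)
rewrite frob_count_binomial; try lia.
have -> : (a1.+1 - a2.+2 + 1 = a1 - a2)%N by lia.
have -> : (m - b2.+2 + 1 = m - b2.+1)%N by lia.
have -> : (a1.+1 + b1.+1 - 2 = a1 + b1)%N by lia.
have -> : (a2.+2 + b1.+1 - 3 = a2 + b1)%N by lia.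
have -> : (a2.+2 + b2.+2 - 4 = a2 + b2)%N by lia.
have -> : (a1.+1 + b2.+2 - 3 = a1 + b2)%N by lia.
have -> : (b2.+2 - 2 = b2)%N by lia.
by have -> : (b1.+1 - 1 = b1)%N by lia.
Qed.
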